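(* Let $t$ be a selfadjoint regular operator on a Hilbert $C^*$-module $E$, and let $C_t=(t-i)(t+i)^{-1}$ be its Cayley transform. Then $t$ is Fredholm if and only if the bounded adjointable operator $I+C_t$ is Fredholm.
   Context: For a Hilbert $C^*$-module $E$, $L(E)$ denotes the bounded adjointable operators on $E$ and $K(E)$ the compact operators on $E$ (the norm closure of the linear span of the operators $z\mapsto x\langle y,z\rangle$, $x,y\in E$). A closed densely defined operator $t:D(t)\subseteq E\to E$ with densely defined adjoint $t^*$ is called regular if $I+t^*t$ has dense range. A regular operator $t$ is selfadjoint if $t=t^*$. A regular operator $t$ is Fredholm if it has a pseudo left inverse and a pseudo right inverse. Here $G\in L(E)$ is a pseudo left inverse of $t$ if $Gt$ is closable, its closure $\overline{Gt}$ lies in $L(E)$, and $\overline{Gt}\equiv 1 \bmod K(E)$; and $G\in L(E)$ is a pseudo right inverse of $t$ if $tG$ is closable, $\overline{tG}\in L(E)$, and $\overline{tG}\equiv 1\bmod K(E)$. For an operator in $L(E)$ this says that it is invertible modulo $K(E)$. For a selfadjoint regular operator $t$, the operators $t+i$ and $t-i$ are bijections from $D(t)$ onto $E$, and $C_t=(t-i)(t+i)^{-1}$ is a bounded adjointable operator on $E$. *)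

(* Defs.v *)
From HB Require Import structures.
From mathcomp Require Import all_boot all_order all_algebra.
From mathcomp Require Import all_classical all_reals topology normedtype.
From mathcomp Require Import complex.

Set Implicit Arguments.
Unset Strict Implicit.
Unset Printing Implicit Defensive.

Import Order.TTheory GRing.Theory Num.Theory.
Import numFieldNormedType.Exports.

Local Open Scope ring_scope.
Local Open Scope classical_set_scope.

(* The algebra is not assumed to have a unit, so the multiplication cannot be
   the one of a MathComp ring. Norms take values in R[i], where [0 <= x] and
   [0 < x] imply that x is real. *)
HB.mixin Record isCstarAlgebra (R : realType) A
    & CompleteNormedModule R[i] A := {
  cmul : A -> A -> A;
  cstar : A -> A;
  cmulA : forall a b c : A, cmul a (cmul b c) = cmul (cmul a b) c;
  cmul_linearl : forall b : A, linear (fun a : A => cmul a b);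
  cmul_linearr : forall a : A, linear (cmul a);
  cstarK : forall a : A, cstar (cstar a) = a;
  cstar_antilinear : forall (k : R[i]) (a b : A),
    cstar (k *: a + b) = (k^*) *: cstar a + cstar b;
  cstarM : forall a b : A, cstar (cmul a b) = cmul (cstar b) (cstar a);
  cnormM : forall a b : A, `|cmul a b| <= `|a| * `|b|;
  cnorm_star : forall a : A, `|cmul (cstar a) a| = `|a| ^+ 2
}.

#[short(type="cstarAlgType")]
HB.structure Definition CstarAlgebra (R : realType) :=
  {A of CompleteNormedModule R[i] A & isCstarAlgebra R A}.

Definition cpositive (R : realType) (A : cstarAlgType R) (a : A) : Prop :=
  exists b : A, a = cmul (cstar b) b.

(* Right modules, with an inner product that is linear in its second argument.
   By [hnormE] the norm of E is the one given by the inner product, which also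
   makes the inner product definite. *)
HB.mixin Record isHilbertModule (R : realType) (A : cstarAlgType R) E
    & CompleteNormedModule R[i] E := {
  hact : E -> A -> E;
  hinner : E -> E -> A;
  hactA : forall (x : E) (a b : A), hact x (cmul a b) = hact (hact x a) b;
  hact_linearl : forall a : A, linear (fun x : E => hact x a);
  hact_linearr : forall x : E, linear (hact x);
  hinner_linearr : forall x : E, linear (hinner x);
  hinner_act : forall (x y : E) (a : A),
    hinner x (hact y a) = cmul (hinner x y) a;
  hinner_star : forall x y : E, cstar (hinner x y) = hinner y x;
  hinner_pos : forall x : E, cpositive (hinner x x);
  hnormE : forall x : E, `|x| ^+ 2 = `|hinner x x|
}.

#[short(type="hilbertModType")]
HB.structure Definition HilbertModule (R : realType) (A : cstarAlgType R) :=
  {E of CompleteNormedModule R[i] E & isHilbertModule R A E}.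

Section BoundedOperators.
Context {R : realType} {A : cstarAlgType R} {E : hilbertModType A}.
Implicit Types T : E -> E.

Definition bounded_operator T : Prop :=
  exists M : R[i], forall x, `|T x| <= M * `|x|.

(* T belongs to L(E) *)
Definition adjointable T : Prop :=
  [/\ linear T, (forall x a, T (hact x a) = hact (T x) a), bounded_operator T &
      exists S : E -> E, forall x y, hinner (T x) y = hinner x (S y)].

Definition rank_one (x y z : E) : E := hact x (hinner y z).

Definition finite_rank T : Prop :=
  exists (n : nat) (c : 'I_n -> R[i]) (x y : 'I_n -> E),
    forall z, T z = \sum_(i < n) c i *: rank_one (x i) (y i) z.

(* T belongs to K(E): operator-norm closure, in L(E), of the finite rank
   operators *)
Definition compact_operator T : Prop :=
  adjointable T /\
  forall e : R[i], 0 < e -> exists F : E -> E,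
    finite_rank F /\ forall z, `|T z - F z| <= e * `|z|.

End BoundedOperators.

(* Unbounded operators are represented by their graphs, so that equality of
   operators is equality of domains and values, and the closure of an operator
   is the topological closure of its graph in E * E. Composition is the one of
   relations: in the notation of the library, [s \; t] applies t first, so it is
   the product s t, with domain the x in D(t) such that t x lies in D(s). *)
Section UnboundedOperators.
Local Open Scope relation_scope.
Context {R : realType} {A : cstarAlgType R} {E : hilbertModType A}.
Implicit Types (s t : set (E * E)) (G : E -> E).

Definition single_valued t : Prop :=
  forall x y z, t (x, y) -> t (x, z) -> y = z.

Definition is_operator t : Prop :=
  [/\ t (0, 0),
      (forall (k : R[i]) x y x' y',
         t (x, y) -> t (x', y') -> t (k *: x + x', k *: y + y')),
      (forall x y a, t (x, y) -> t (hact x a, hact y a)) &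
      single_valued t].

Definition op_domain t : set E := fst @` t.
Definition op_range t : set E := snd @` t.

Definition op_fun (f : E -> E) : set (E * E) := [set p | p.2 = f p.1].

Definition op_scalar (k : R[i]) : set (E * E) := op_fun (fun x => k *: x).

Definition op_add s t : set (E * E) :=
  [set p | exists y z, [/\ s (p.1, y), t (p.1, z) & p.2 = y + z]].

(* single-valued when the domain of t is dense *)
Definition op_adjoint t : set (E * E) :=
  [set p | forall x y, t (x, y) -> hinner y p.1 = hinner x p.2].

Definition regular t : Prop :=
  [/\ is_operator t, closed t, dense (op_domain t),
      dense (op_domain (op_adjoint t)) &
      dense (op_range (op_add (op_scalar 1) (op_adjoint t \; t)))].

Definition selfadjoint t : Prop := t = op_adjoint t.

Definition closable t : Prop := single_valued (closure t).

(* the closure of t lies in L(E) and is the identity modulo K(E) *)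
Definition closure_one_mod_compact t : Prop :=
  exists T : E -> E, [/\ adjointable T, closure t = op_fun T &
    compact_operator (fun x => T x - x)].

Definition pseudo_left_inverse G t : Prop :=
  [/\ adjointable G, closable (op_fun G \; t) &
      closure_one_mod_compact (op_fun G \; t)].

Definition pseudo_right_inverse G t : Prop :=
  [/\ adjointable G, closable (t \; op_fun G) &
      closure_one_mod_compact (t \; op_fun G)].

Definition fredholm t : Prop :=
  (exists G, pseudo_left_inverse G t) /\ (exists G, pseudo_right_inverse G t).

Definition cayley t : set (E * E) :=
  op_add t (op_scalar (- 'i)) \; (op_add t (op_scalar 'i))^-1.

End UnboundedOperators.

(* Main.v *)
Require Import Defs.
From mathcomp Require Import all_boot all_order all_algebra.
From mathcomp Require Import all_classical all_reals topology normedtype.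
From mathcomp Require Import complex.

Set Implicit Arguments.
Unset Strict Implicit.
Unset Printing Implicit Defensive.

Import Order.TTheory GRing.Theory Num.Theory.
Import numFieldNormedType.Exports.

Local Open Scope ring_scope.
Local Open Scope classical_set_scope.

(** Write i for the imaginary unit. Since t is selfadjoint and regular, t + i
    maps D(t) one-to-one onto E and its inverse Q is a bounded adjointable
    operator; this is [resolvent_exists]. The Cayley transform is
    C = 1 - 2iQ, so that I + C is the everywhere defined operator
    B = 2 (1 - iQ) = 2 t Q ([cayley_graph]). Pseudo-inverses of t and of B are
    exchanged by explicit formulas:

    - if G t has closure T, then (T + iG) / 2 is the bounded form of
      G (t + i) / 2, and (T + iG) B / 2 = T;
    - if t G has closure T, then t G = T already, because t G is closed and
      hence everywhere defined, and B (T + iG) / 2 = T;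
    - if G B = T, then 2 G Q t is the restriction of T to D(t);
    - if B G = T, then t (2 Q G) = T.

    In each case the new product has closure exactly T, the same operator as the
    old one, so that being 1 modulo the compact operators carries over with no
    computation in the quotient by K(E).

    The analytic part is the existence of Q. Its core is the estimate
    |x| <= 3 |t x + k x| for x in D(t) and k = i or k = -i
    ([symmetric_pair_bound]); the constant is not optimal, but it is obtained
    from the inner product and the triangle inequality alone, with neither
    the order of the C*-algebra nor the Cauchy-Schwarz inequality. As t is
    closed, it follows that t + k is injective with closed range. The range
    is dense because 1 + t t = (t + k) (t - k) has dense range, so t + k is
    onto. The adjoint of (t + k)^-1 is (t - k)^-1. *)

(** * A lower bound for symmetric operators *)

(** If 3 b < a, then 9 (b + a)^2 < 16 a^2, whereas the hypothesis gives
    18 a^2 <= 9 (b + a)^2. The elements a and b are comparable, being real, even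
    when the order of K is partial, as it is on the complex numbers. *)
Lemma le_of_double_sqr_le (K : numDomainType) (a b : K) : 0 <= a -> 0 <= b ->
  4%:R * a ^+ 2 <= 2%:R * (b + a) ^+ 2 -> a <= 3%:R * b.
Proof.
move=> a0 b0 key; rewrite real_leNgt ?realM ?ger0_real//; apply/negP => lt.
have lt2 : 9%:R * (b + a) ^+ 2 < 16%:R * a ^+ 2.
  have : (3%:R * (b + a)) ^+ 2 < (4%:R * a) ^+ 2.
    rewrite ltrXn2r ?mulr_ge0 ?addr_ge0// mulrDr.
    have -> : 4%:R * a = a + 3%:R * a by rewrite !mulr_natl -mulrS.
    by rewrite ltrD2r.
  by rewrite !exprMn -!natrX.
have /le_lt_trans/(_ lt2) : 18%:R * a ^+ 2 <= 9%:R * (b + a) ^+ 2.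
  rewrite -(@ler_pM2l _ 2%:R)// mulrA -natrM [leRHS]mulrCA.
  apply: le_trans (_ : 9%:R * (4%:R * a ^+ 2) <= _).
    by rewrite [leRHS]mulrA -natrM.
  by rewrite ler_pM2l.
apply/negP; rewrite -real_leNgt ?realM ?realX ?ger0_real//.
by rewrite ler_wpM2r ?exprn_ge0// ler_nat.
Qed.

Section InnerProduct.
Context {R : realType} {A : cstarAlgType R} {E : hilbertModType A}.
Implicit Types (x y z w : E) (k : R[i]).

Lemma hinnerDr x y z : hinner x (y + z) = hinner x y + hinner x z.
Proof. by have := hinner_linearr x 1 y z; rewrite !scale1r. Qed.

Lemma hinnerr0 x : hinner x 0 = 0.
Proof. by apply: (@addIr _ (hinner x 0)); rewrite -hinnerDr !add0r. Qed.

Lemma hinnerZr k x y : hinner x (k *: y) = k *: hinner x y.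
Proof. by have := hinner_linearr x k y 0; rewrite hinnerr0 !addr0. Qed.

Lemma hinnerDl x y z : hinner (x + y) z = hinner x z + hinner y z.
Proof.
rewrite -(hinner_star z) hinnerDr -(hinner_star z x) -(hinner_star z y).
have := cstar_antilinear 1 (hinner z x) (hinner z y).
by rewrite conjC1 !scale1r.
Qed.

Lemma hinnerZl k x y : hinner (k *: x) y = k^* *: hinner x y.
Proof.
have cstar0 : cstar (0 : A) = 0 by rewrite -(hinnerr0 (0 : E)) hinner_star.
rewrite -(hinner_star y) hinnerZr -(hinner_star y x).
by have := cstar_antilinear k (hinner y x) 0; rewrite cstar0 !addr0.
Qed.

Lemma norm_unit_imaginary k : k ^+ 2 = -1 -> `|k| = 1.
Proof.
by move=> k2; apply/eqP; rewrite -sqrp_eq1// -normrX k2 normrN1.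
Qed.

(** Put u = w + k x and v = k u. Then v + x = k w, and symmetry of the pair
    (x, w) makes <k w, x> antisymmetric, so that the cross terms add up in
    <v - x, v - x> = <v + x, v + x> + 4 <x, x>. Taking norms gives
    4 |x|^2 <= |v - x|^2 + |v + x|^2 <= 2 (|v| + |x|)^2, with |v| = |u|. *)
Lemma symmetric_pair_bound k x w : k ^+ 2 = -1 -> k^* = - k ->
  hinner w x = hinner x w -> `|x| <= 3%:R * `|w + k *: x|.
Proof.
move=> k2 kc sym; set u := w + k *: x; set v := k *: u.
have vE : v + x = k *: w.
  by rewrite /v /u scalerDr scalerA -expr2 k2 scaleN1r addrNK.
have nv : `|v| = `|u| by rewrite normrZ norm_unit_imaginary ?mul1r.
have asym : hinner (v + x) x = - hinner x (v + x).
  by rewrite vE hinnerZl hinnerZr kc scaleNr sym.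
have key : 4%:R *: hinner x x = hinner (v - x) (v - x) - hinner (v + x) (v + x).
  have -> : v - x = (v + x) + (- 2%:R) *: x.
    by rewrite scaleNr scaler_nat mulr2n opprD addrACA subrr addr0.
  move: (v + x) asym => p asym.
  rewrite hinnerDl !hinnerDr !hinnerZl !hinnerZr asym rmorphN rmorph_nat.
  rewrite scalerN !scaleNr opprK scalerN scalerA -natrM.
  by rewrite opprK [_ + (_ + _)]addrA addrK addrAC subrr add0r.
have {}key : 4%:R * `|x| ^+ 2 <= 2%:R * (`|v| + `|x|) ^+ 2.
  rewrite hnormE -[X in X * _](@normr_nat (R[i])) -normrZ key.
  rewrite (le_trans (ler_normB _ _))// -!hnormE mulr_natl mulr2n.
  by rewrite lerD// lerXn2r ?nnegrE ?addr_ge0 ?ler_normB ?ler_normD.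
by rewrite -nv; apply: le_of_double_sqr_le.
Qed.

End InnerProduct.

(** * Closed graphs and closed ranges *)

Section BoundedMaps.
Context {R : realType} {V W : normedModType R[i]}.
Implicit Types (T : V -> W) (D : set V).

(** The bound M is a complex number, a priori not real when V = 0; its modulus
    is a bound as well. *)
Lemma bounded_linear_continuous T (M : R[i]) : linear T ->
  (forall x, `|T x| <= M * `|x|) -> continuous T.
Proof.
move=> linT bT x.
have M0 : 0 < `|M| + 1 by rewrite ltr_wpDl.
apply/cvgrPdist_lt => e e0; near=> z.
have -> : T x - T z = T (x - z).
  by have := linT (-1) z x; rewrite !scaleN1r !(addrC (- _)) => ->.
apply: (@le_lt_trans _ _ ((`|M| + 1) * `|x - z|)).
  have := ger0_real (le_trans (normr_ge0 _) (bT (x - z))).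
  move=> /real_ler_norm/(le_trans (bT _))/le_trans; apply.
  by rewrite normrM normr_id ler_wpM2r// lerDl.
rewrite mulrC -ltr_pdivlMr//; near: z.
apply: cvgr_dist_lt; first exact: cvg_id.
by rewrite divr_gt0.
Unshelve. all: by end_near. Qed.

(** Both extremes are used: D = D(t), to compute the closure of an operator
    that extends boundedly, and D = V, to see that the graph of T is closed. *)
Lemma closure_graph_on_dense T D : continuous T -> dense D ->
  closure [set p : V * W | D p.1 /\ p.2 = T p.1] = [set p | p.2 = T p.1].
Proof.
move=> cT dD; apply/seteqP; split => [p clp|[x _] /= -> B [[U V1] /= [Ux VTx] UVB]].
  apply/eqP; rewrite -subr_eq0; apply/eqP.
  have : closed [set q : V * W | (q.2 - T q.1) = 0].
    apply: (@preimage_closed _ _ (fun q : V * W => q.2 - T q.1) [set 0]).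
      move=> q _; apply: cvgB; first exact: cvg_snd.
      apply: (@cvg_comp _ _ _ fst T); [exact: cvg_fst|exact: cT].
    exact/accessible_closed_set1/hausdorff_accessible/norm_hausdorff.
  by apply; apply: closureS clp => q [_ /= ->]; rewrite subrr.
have /dD : exists z, (U `&` (T @^-1` V1))^° z.
  by exists x; apply: filterI => //; apply: cT.
case/(_ (open_interior _)) => z [/interior_subset[Uz Vz] Dz].
by exists (z, T z); split => //; apply: UVB.
Qed.

(** A closed operator bounded below has closed range: the preimages of points
    converging to w form a Cauchy filter, and its limit is a preimage of w
    because s is closed. *)
Lemma closed_relation_surjective (V' : completeNormedModType R[i])
    (s : set (V' * W)) (C : R[i]) : 0 < C -> closed s -> dense (snd @` s) ->
  (forall x w x' w', s (x, w) -> s (x', w') -> `|x - x'| <= C * `|w - w'|) ->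
  forall w, exists x, s (x, w).
Proof.
move=> C0 cls dr lip w.
(* every neighbourhood of w meets the range of s *)
have meet (U : set W) : nbhs w U -> exists2 p, s p & U p.2.
  rewrite nbhsE => -[O [oO Ow] OU]; have [|y [Oy [p sp py]]] := dr O _ oO.
    by exists w.
  by exists p => //; rewrite py; apply: OU.
pose F := filter_from (nbhs w) (fun U => [set x | exists2 y, U y & s (x, y)]).
have FF : ProperFilter F.
  apply: filter_from_proper.
    apply: filter_from_filter; first by exists setT; apply: filterT.
    move=> U U' nU nU'; exists (U `&` U'); first exact: filterI.
    by move=> x [y [Uy U'y] sxy]; split; exists y.
  by move=> U /meet [[x y] sxy Uy]; exists x, y.
have : cauchy F.
  apply: cauchy_exP => e e0.
  have e1 : 0 < e / C / 2 by rewrite !divr_gt0.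
  have [[x y] sxy /= xy] := meet _ (nbhsx_ballx w _ e1).
  exists x, (ball w (e / C / 2)); first exact: nbhsx_ballx.
  move=> x' [y' wy' sxy']; rewrite -ball_normE /=.
  apply: (le_lt_trans (lip _ _ _ _ sxy sxy')).
  rewrite mulrC -ltr_pdivlMr//.
  have := ball_triangle (ball_sym xy) wy'; rewrite -ball_normE /=.
  by rewrite -splitr.
move/cauchy_cvg/cvg_ex => [x Fx]; exists x.
apply: cls => B [[U V1] /= [Ux V1w] UVB].
have [U' nU' U'U] := Fx _ Ux.
have [[x' y'] s' [U'y' V1y']] := meet _ (filterI nU' V1w).
exists (x', y'); split=> //; apply: UVB; split => //=; apply: U'U; by exists y'.
Qed.

End BoundedMaps.

(** * Adjointable operators and their graphs *)

Section AdjointableOperators.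
Context {R : realType} {A : cstarAlgType R} {E : hilbertModType A}.
Implicit Types (S T : E -> E) (k : R[i]).

Lemma bounded_operator_ge0 T : bounded_operator T ->
  exists2 M : R[i], 0 <= M & forall x, `|T x| <= M * `|x|.
Proof.
case=> M bT; exists `|M| => // x.
have /real_ler_norm := ger0_real (le_trans (normr_ge0 _) (bT x)).
by rewrite normrM normr_id; apply: le_trans.
Qed.

Lemma adjointable_continuous T : adjointable T -> continuous T.
Proof. by case=> linT _ [M bT] _; apply: bounded_linear_continuous bT. Qed.

Lemma adjointable_linearD T : adjointable T -> {morph T : x y / x + y}.
Proof. by case=> linT _ _ _ x y; have := linT 1 x y; rewrite !scale1r. Qed.

Lemma adjointable_linearZ k T : adjointable T ->
  {morph T : x / k *: x}.
Proof.
move=> adjT x; have T0 : T 0 = 0.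
  by apply: (@addIr _ (T 0)); rewrite -(adjointable_linearD adjT) !add0r.
by case: adjT => linT _ _ _; have := linT k x 0; rewrite T0 !addr0.
Qed.

Lemma adjointable_comp S T : adjointable S -> adjointable T ->
  adjointable (S \o T).
Proof.
move=> [linS actS /bounded_operator_ge0[M M0 bS] [S' adjS]].
move=> [linT actT [N bT] [T' adjT]]; split.
- by move=> k x y /=; rewrite linT linS.
- by move=> x a /=; rewrite actT actS.
- exists (M * N) => x /=; rewrite -mulrA.
  by apply: le_trans (bS _) _; rewrite ler_wpM2l.
- by exists (T' \o S') => x y /=; rewrite adjS adjT.
Qed.

Lemma adjointableZ k T : adjointable T -> adjointable (fun x => k *: T x).
Proof.
move=> [linT actT [M bT] [T' adjT]]; split.
- by move=> a x y; rewrite linT scalerDr !scalerA mulrC.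
- move=> x a; rewrite actT.
  have h0 : hact (0 : E) a = 0.
    have := hact_linearl a 1 (0 : E) 0.
    by rewrite !scale1r addr0 => /(canLR (addrK _)); rewrite subrr.
  by have := hact_linearl a k (T x) 0; rewrite h0 !addr0 => ->.
- by exists (`|k| * M) => x; rewrite normrZ -mulrA ler_wpM2l.
- exists (fun y => k^* *: T' y) => x y.
  by rewrite hinnerZl hinnerZr adjT.
Qed.

Lemma adjointableD S T : adjointable S -> adjointable T ->
  adjointable (fun x => S x + T x).
Proof.
move=> [linS actS [M bS] [S' adjS]] [linT actT [N bT] [T' adjT]]; split.
- by move=> a x y; rewrite linT linS scalerDr addrACA.
- move=> x a; rewrite actS actT.
  by have := hact_linearl a 1 (S x) (T x); rewrite !scale1r => ->.
- exists (M + N) => x; rewrite mulrDl.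
  by rewrite (le_trans (ler_normD _ _))// lerD.
- exists (fun y => S' y + T' y) => x y.
  by rewrite hinnerDl hinnerDr adjS adjT.
Qed.

Lemma closure_op_fun T : adjointable T -> closure (op_fun T) = op_fun T.
Proof.
move=> /adjointable_continuous cT.
have dT : dense (@setT E) by move=> O [x Ox] _; exists x.
rewrite /op_fun -[RHS](closure_graph_on_dense cT dT); congr closure.
by apply/seteqP; split => // p [].
Qed.

Lemma comp_op_fun (s : set (E * E)) T :
  (s \; op_fun T)%relation = [set p | s (T p.1, p.2)].
Proof.
rewrite /op_fun; apply/seteqP; split => [[x y] [_ /= ->//]|[x y] /= sTxy].
by exists (T x).
Qed.

Lemma op_fun_comp S T : (op_fun S \; op_fun T)%relation = op_fun (S \o T).
Proof. by rewrite comp_op_fun. Qed.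

Lemma closure_one_mod_compact_closable (s : set (E * E)) :
  closure_one_mod_compact s -> closable s.
Proof. by case=> T [_ clT _]; rewrite /closable clT /op_fun => x y z /= -> ->. Qed.

End AdjointableOperators.

(** * Resolvents of a selfadjoint regular operator *)

Section Resolvent.
Context {R : realType} {A : cstarAlgType R} {E : hilbertModType A}.
Variable t : set (E * E).
Hypotheses (t_regular : regular t) (t_selfadjoint : selfadjoint t).

Lemma selfadjoint_symmetric x w x' w' : t (x, w) -> t (x', w') ->
  hinner w x' = hinner x w'.
Proof.
by move=> txw; rewrite [X in X _ -> _]t_selfadjoint; apply.
Qed.

Lemma shift_bound (k : R[i]) x w x' w' :
  k ^+ 2 = -1 -> k^* = - k -> t (x, w) -> t (x', w') ->
  `|x - x'| <= 3%:R * `|(w + k *: x) - (w' + k *: x')|.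
Proof.
case: t_regular => [[_ tlin _ _] _ _ _ _] k2 kc txw txw'.
have td : t (x - x', w - w').
  by have := tlin (-1) _ _ _ _ txw' txw; rewrite !scaleN1r !(addrC (- _)).
rewrite opprD addrACA -scalerBr; apply: symmetric_pair_bound => //.
exact: selfadjoint_symmetric.
Qed.

(** Surjectivity of t + k. Density of its range: for x in D(t t),
    (t + k) (t x - k x) = t t x - k^2 x = t t x + x. *)
Lemma shift_surjective (k : R[i]) y : k ^+ 2 = -1 -> k^* = - k ->
  exists x, t (x, y - k *: x).
Proof.
case: t_regular => [[_ tlin _ _] tcl _ _ trange] k2 kc.
apply: (@closed_relation_surjective _ _ E
  [set p : E * E | t (p.1, p.2 - k *: p.1)] 3%:R) => //.
- apply: (@preimage_closed _ _ (fun p : E * E => (p.1, p.2 - k *: p.1)) t) => // p _.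
  apply: cvg_pair; first exact: cvg_fst.
  by apply: cvgB; [exact: cvg_snd|apply: cvgZl_tmp; exact: cvg_fst].
- move=> O O0 oO; have [u [Ou [[x z] [x1 [v [/= x1E [w /= txw twz] zE]] /= uE]]]] :=
    trange O O0 oO.
  (* the preimage of x + t (t x) under t + k is t x - k x *)
  rewrite -t_selfadjoint in twz; rewrite /op_scalar /op_fun /= in x1E.
  exists u; split => //; exists (w - k *: x, u) => //=.
  have := tlin (- k) _ _ _ _ txw twz; rewrite !scaleNr !(addrC (- _)).
  rewrite -uE zE x1E scalerBr scalerA -expr2 k2 scaleN1r opprK scale1r.
  by rewrite (addrC x) opprD addrACA subrr addr0.
- move=> x w x' w' /= s s'; have := shift_bound k2 kc s s'.
  by rewrite !subrK.
Qed.

(** Linearity over R[i] and A follows from uniqueness of preimages, and the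
    adjoint of (t + k)^-1 is (t - k)^-1 because k is purely imaginary. *)
Lemma resolvent_exists (k : R[i]) : k ^+ 2 = -1 -> k^* = - k ->
  exists Q : E -> E, [/\ adjointable Q, forall y, t (Q y, y - k *: Q y) &
    forall x w, t (x, w) -> Q (w + k *: x) = x].
Proof.
move=> k2 kc; case: t_regular => [[_ tlin tact _] _ _ _ _].
have [Q tQ] := choice (fun y => shift_surjective y k2 kc).
have Nk2 : (- k) ^+ 2 = -1 by rewrite sqrrN.
have Nkc : (- k)^* = - - k by rewrite rmorphN /= kc.
have [Q' tQ'] := choice (fun y => shift_surjective y Nk2 Nkc).
have QK x w : t (x, w) -> Q (w + k *: x) = x.
  move=> txw.
  have := shift_bound k2 kc (tQ (w + k *: x)) txw.
  by rewrite subrK subrr normr0 mulr0 normr_le0 subr_eq0 => /eqP.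
exists Q; split => //; split.
- move=> a x y; have /QK := tlin a _ _ _ _ (tQ x) (tQ y).
  suff -> : a *: (x - k *: Q x) + (y - k *: Q y) + k *: (a *: Q x + Q y) =
    a *: x + y by [].
  rewrite (scalerDr k) addrACA subrK scalerA mulrC -scalerA -scalerDr.
  by rewrite subrK.
- move=> x a; have /QK := tact _ _ a (tQ x).
  suff -> : hact (x - k *: Q x) a + k *: hact (Q x) a = hact x a by [].
  have := hact_linearl a k (Q x) (x - k *: Q x).
  by rewrite (addrC _ (x - _)) subrK addrC => ->.
- exists 3%:R => y; have := symmetric_pair_bound k2 kc
    (selfadjoint_symmetric (tQ y) (tQ y)).
  by rewrite subrK.
- exists Q' => x y.
  have := selfadjoint_symmetric (tQ x) (tQ' y).
  rewrite scaleNr opprK -scaleNr hinnerDl hinnerDr hinnerZl hinnerZr Nkc.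
  by rewrite opprK => /addIr.
Qed.

End Resolvent.

(** * Transfer of pseudo-inverses through the Cayley transform *)

Section CayleyTransform.
Local Open Scope relation_scope.
Context {R : realType} {A : cstarAlgType R} {E : hilbertModType A}.
Variable t : set (E * E).
Hypothesis t_operator : is_operator t.
Hypothesis t_closed : closed t.
Hypothesis t_dense : dense (op_domain t).
Variable Q : E -> E.
Hypothesis Q_adj : adjointable Q.
Hypothesis tQ : forall y, t (Q y, y - 'i *: Q y).
Hypothesis QK : forall x w, t (x, w) -> Q (w + 'i *: x) = x.

Let B (x : E) : E := 2%:R *: (x - 'i *: Q x).

(** From (t + i) Q = 1 one gets (t - i) Q = 1 - 2iQ. *)
Lemma cayley_graph : op_add (op_scalar 1) (cayley t) = op_fun B.
Proof.
case: t_operator => _ tlin _ tfun; rewrite /cayley /op_scalar /op_fun.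
apply/seteqP; split => [[a b]|[a b]] /=.
  move=> [_ [c [/= -> [x [w [_ [/= txw -> aE]]] [w' [_ [/= txw' -> cE]]]] bE]]].
  rewrite {}bE {}cE -(tfun _ _ _ txw txw') /B {}aE (QK txw) scale1r.
  by rewrite addrK scaleNr addrACA subrr addr0 scaler_nat mulr2n.
rewrite /B => bE; exists a, (b - a); split=> /=.
- by rewrite scale1r.
- exists (Q a).
    by exists (a - 'i *: Q a), ('i *: Q a); split => //=; rewrite subrK.
  exists (a - 'i *: Q a), (- 'i *: Q a); split => //=.
  rewrite {}bE scaler_nat mulr2n scaleNr.
  by rewrite -addrA; congr (_ + _); rewrite addrAC subrr add0r.
- by rewrite addrC subrK.
Qed.

(** The operator T extends G t, so T Q = G t Q = G (1 - iQ) and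
    (T + iG) (1 - iQ) = T (1 - iQ) + i T Q = T. *)
Lemma left_inverse_cayley G : pseudo_left_inverse G t ->
  exists G', pseudo_left_inverse G' (op_fun B).
Proof.
move=> [adjG _ [T [adjT clT cptT]]].
have TG x w : t (x, w) -> T x = G w.
  move=> txw; have : closure (op_fun G \; t) (x, G w).
    by apply: subset_closure; exists w.
  by rewrite clT.
pose Y x := 2%:R^-1 *: (T x + 'i *: G x).
have adjY : adjointable Y by apply/adjointableZ/adjointableD/adjointableZ.
exists Y; have comp : op_fun Y \; op_fun B = op_fun T.
  rewrite op_fun_comp; congr op_fun; apply/funext => x /=.
  rewrite /B (adjointable_linearZ _ adjY) /Y scalerA divff ?pnatr_eq0// scale1r.
  rewrite -(TG _ _ (tQ x)) -(adjointable_linearZ _ adjT).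
  by rewrite -(adjointable_linearD adjT) subrK.
have one : closure_one_mod_compact (op_fun T).
  by exists T; split => //; apply: closure_op_fun.
by split; rewrite ?comp//; apply: closure_one_mod_compact_closable.
Qed.

(** A product of the closed operator t with the bounded operator G is closed,
    so t G equals its closure T and G maps E into D(t). Then T + iG is
    (t + i) G, whence Q (T + iG) = G and (1 - iQ) (T + iG) = T. *)
Lemma right_inverse_cayley G : pseudo_right_inverse G t ->
  exists G', pseudo_right_inverse G' (op_fun B).
Proof.
move=> [adjG _ [T [adjT clT cptT]]].
have tG x : t (G x, T x).
  have closed_tG : closed (t \; op_fun G).
    rewrite comp_op_fun.
    apply: (@preimage_closed _ _ (fun p : E * E => (G p.1, p.2)) t) t_closed => p _.
    apply: cvg_pair; last exact: cvg_snd.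
    apply: (@cvg_comp _ _ _ fst G); first exact: cvg_fst.
    exact: adjointable_continuous.
  have : op_fun T (x, T x) by [].
  by rewrite -clT -((closure_id _).1 closed_tG) comp_op_fun.
pose X x := 2%:R^-1 *: (T x + 'i *: G x).
have adjX : adjointable X by apply/adjointableZ/adjointableD/adjointableZ.
exists X; have comp : op_fun B \; op_fun X = op_fun T.
  rewrite op_fun_comp; congr op_fun; apply/funext => x /=.
  rewrite /B /X (adjointable_linearZ _ Q_adj) (QK (tG x)).
  rewrite scalerA mulrC -scalerA -scalerBr scalerA divff ?pnatr_eq0// scale1r.
  by rewrite addrK.
have one : closure_one_mod_compact (op_fun T).
  by exists T; split => //; apply: closure_op_fun.
by split; rewrite ?comp//; apply: closure_one_mod_compact_closable.
Qed.

(** On D(t) the operators Q t and 1 - iQ agree, so 2 G Q t is the restriction of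
    G B to D(t); as D(t) is dense, its closure is G B. *)
Lemma left_inverse_of_cayley G : pseudo_left_inverse G (op_fun B) ->
  exists G', pseudo_left_inverse G' t.
Proof.
move=> [adjG _ [T [adjT clT cptT]]].
have TE x : T x = G (B x).
  have : closure (op_fun G \; op_fun B) (x, G (B x)).
    by apply: subset_closure; exists (B x).
  by rewrite clT.
exists (fun x => 2%:R *: G (Q x)); set Y := (fun x => _).
have adjY : adjointable Y by apply/adjointableZ/adjointable_comp.
have YE x w : t (x, w) -> Y w = T x.
  move=> txw; rewrite TE /B (adjointable_linearZ _ adjG) /Y; congr (_ *: G _).
  rewrite -[in X in _ = X - _](QK txw) (adjointable_linearD Q_adj).
  by rewrite (adjointable_linearZ _ Q_adj) addrK.
have one : closure_one_mod_compact (op_fun Y \; t).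
  exists T; split => //.
  rewrite /op_fun -(closure_graph_on_dense (adjointable_continuous adjT) t_dense).
  congr closure; apply/seteqP; split => [[x z]|[x z]] /=.
    by rewrite /op_fun => -[w txw /= ->]; split; [exists (x, w)|apply: YE].
  by move=> [[[x1 w] txw /= <-] ->]; exists w => //=; rewrite (YE _ _ txw).
by split => //; apply: closure_one_mod_compact_closable.
Qed.

(** As t Q = 1 - iQ, the operators t (2 Q G) and B G are equal, not only their
    closures. *)
Lemma right_inverse_of_cayley G : pseudo_right_inverse G (op_fun B) ->
  exists G', pseudo_right_inverse G' t.
Proof.
move=> [adjG clsG oneG]; case: t_operator => t0 tlin _ tfun.
exists (fun x => 2%:R *: Q (G x)); set X := (fun x => _).
have adjX : adjointable X by apply/adjointableZ/(adjointable_comp Q_adj).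
have tX x : t (X x, B (G x)).
  by have := tlin 2%:R _ _ _ _ (tQ (G x)) t0; rewrite !addr0.
have tXE : t \; op_fun X = op_fun B \; op_fun G.
  rewrite !comp_op_fun; apply/seteqP; split => [[x y] /= tXy|[x y]].
    exact: tfun tXy (tX x).
  by rewrite /op_fun /= => ->; apply: tX.
by split=> //; rewrite tXE.
Qed.

End CayleyTransform.

Theorem theorem1p4 (R : realType) (A : cstarAlgType R) (E : hilbertModType A)
    (t : set (E * E)) (t_regular : regular t) (t_selfadjoint : selfadjoint t) :
  fredholm t <-> fredholm (op_add (op_scalar 1%R) (cayley t)).
Proof.
have [Q [adjQ tQ QK]] := resolvent_exists t_regular t_selfadjoint
  (@sqrCi R[i]) (@conjCi R[i]).
case: t_regular => t_op t_closed t_dense _ _.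
rewrite (cayley_graph t_op tQ QK); split=> -[[L leftL] [G rightG]].
  split.
    exact: left_inverse_cayley tQ _ leftL.
  exact: right_inverse_cayley QK _ rightG.
split.
  exact: left_inverse_of_cayley QK _ leftL.
exact: right_inverse_of_cayley tQ _ rightG.
Qed.
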